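(* Let $\Omega\subset\mathbb M_k$ be an open unitarily-invariant nc set and let $f\colon\Omega\to\mathrm{Max}(\overline{\mathbb B_d})$ be a locally bounded nc (holomorphic) function. If for some $W_0\in\Omega$ we have $f(W_0)\in\partial\,\mathrm{Max}(\overline{\mathbb B_d})$, then $f$ is constant.
   Context: $\mathbb M_k=\bigsqcup_{n\ge1}M_n(\mathbb C)^k$; for $\Omega\subset\mathbb M_k$, $\Omega(n)=\Omega\cap M_n(\mathbb C)^k$. $\Omega$ is an nc set if $X,Y\in\Omega$ implies $X\oplus Y\in\Omega$; it is open if every $\Omega(n)$ is open; it is unitarily invariant if $U^*XU\in\Omega(n)$ for every $X\in\Omega(n)$ and unitary $U\in M_n(\mathbb C)$. An nc function $f\colon\Omega\to\mathbb M_d$ satisfies $f(\Omega(n))\subset M_n(\mathbb C)^d$, $f(X\oplus Y)=f(X)\oplus f(Y)$, and $f(S^{-1}XS)=S^{-1}f(X)S$ whenever $X,S^{-1}XS\in\Omega(n)$, $S\in GL_n(\mathbb C)$; locally bounded nc functions are holomorphic on each level. $f$ is constant if there is $\lambda\in\mathbb C^d$ with $f(W)=(\lambda_1I_n,\dots,\lambda_dI_n)$ for all $n$ and $W\in\Omega(n)$. $\mathrm{Max}(\overline{\mathbb B_d})=\bigsqcup_n\mathrm{Max}(\overline{\mathbb B_d})(n)$, where $$\mathrm{Max}(\overline{\mathbb B_d})(n)=\Big\{Z\in M_n(\mathbb C)^d:\ \mathrm{Re}\Big(\sum_{j=1}^d\overline{w_j}Z_j\Big)\le I_n\ \ \forall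 w\in\mathbb C^d,\ \|w\|\le1\Big\},$$ with $\mathrm{Re}(A)=\frac12(A+A^* )$ and $\|w\|$ the Euclidean norm. The boundary $\partial\,\mathrm{Max}(\overline{\mathbb B_d})$ is taken level-wise, in $M_n(\mathbb C)^d$. *)

(* Defs.v *)
From HB Require Import structures.
From mathcomp Require Import all_boot all_order all_algebra.
From mathcomp Require Import all_classical all_reals all_analysis.
From mathcomp Require Import complex.

Set Implicit Arguments.
Unset Strict Implicit.
Unset Printing Implicit Defensive.

Import Order.TTheory GRing.Theory Num.Theory.
Import numFieldNormedType.Exports.
Import ArrowAsProduct.

Local Open Scope classical_set_scope.
Local Open Scope ring_scope.
Local Open Scope sesquilinear_scope.

(* R[i] itself carries no topology; seen through its numClosedFieldType
   structure it gets the one induced by the modulus, and matrices and tuples of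
   matrices over it get the product topologies. In the order of a
   numClosedFieldType, 0 <= z means that z is real and nonnegative. *)
Definition CC (R : realType) : numClosedFieldType := R[i].

Definition boundary (T : topologicalType) (A : set T) : set T :=
  closure A `\` A°.

Definition mxtuple (R : realType) (k n : nat) : Type := 'I_k -> 'M[CC R]_n.

(* The sizes in the nc universe start at 1, hence the empty level 0. *)
Record ncsubset (R : realType) (k : nat) := NCSubset {
  level :> forall n, set (mxtuple R k n);
  level0 : @level 0%N = set0 }.
Arguments level {R k} _ n _.

(* A function on Omega is represented by a total graded function; its values
   outside Omega are never used. *)
Definition ncmap (R : realType) (k d : nat) : Type :=
  forall n, mxtuple R k n -> mxtuple R d n.

Section NC.
Variable R : realType.
Local Notation C := (CC R).

Definition dirsum k m n (X : mxtuple R k m) (Y : mxtuple R k n) :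
  mxtuple R k (m + n) := fun j => block_mx (X j) 0 0 (Y j).

Definition similar k n (S : 'M[C]_n) (X : mxtuple R k n) : mxtuple R k n :=
  fun j => invmx S *m X j *m S.

Definition is_nc_set k (Omega : ncsubset R k) : Prop :=
  forall m n (X : mxtuple R k m) (Y : mxtuple R k n),
    Omega m X -> Omega n Y -> Omega (m + n)%N (dirsum X Y).

Definition nc_open k (Omega : ncsubset R k) : Prop :=
  forall n, open (Omega n).

Definition unitarily_invariant k (Omega : ncsubset R k) : Prop :=
  forall n (X : mxtuple R k n) (U : 'M[C]_n),
    Omega n X -> U \is unitarymx -> Omega n (fun j => U^t* *m X j *m U).

Definition nc_function k d (Omega : ncsubset R k) (f : ncmap R k d) : Prop :=
  (forall m n (X : mxtuple R k m) (Y : mxtuple R k n),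
     Omega m X -> Omega n Y ->
     f (m + n)%N (dirsum X Y) = dirsum (f m X) (f n Y)) /\
  (forall n (X : mxtuple R k n) (S : 'M[C]_n),
     S \in unitmx -> Omega n X -> Omega n (similar S X) ->
     f n (similar S X) = similar S (f n X)).

Definition locally_bounded k d (Omega : ncsubset R k) (f : ncmap R k d) : Prop :=
  forall n (W : mxtuple R k n), Omega n W ->
  forall j : 'I_d,
    bounded_near (fun X => f n X j) (within (Omega n) (nbhs W)).

Definition nc_constant k d (Omega : ncsubset R k) (f : ncmap R k d) : Prop :=
  exists lambda : 'I_d -> C, forall n (W : mxtuple R k n),
    Omega n W -> f n W = fun j => (lambda j)%:M.

Definition lemx n (A B : 'M[C]_n) : Prop :=
  forall v : 'cV[C]_n, 0 <= (v^t* *m (B - A) *m v) 0 0.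

Definition Remx n (A : 'M[C]_n) : 'M[C]_n := 2^-1 *: (A + A^t*).

Definition enorm d (w : 'I_d -> C) : C := sqrtC (\sum_(j < d) `|w j| ^+ 2).

Definition maxball d n : set (mxtuple R d n) :=
  [set Z | forall w : 'I_d -> C, enorm w <= 1 ->
     lemx (Remx (\sum_(j < d) (w j)^* *: Z j)) 1%:M].

End NC.
Arguments maxball R d n _ : clear implicits.

(* Main.v *)
(* Put [x = v (+) 0] and [y = 0 (+) u] with unit vectors [v], [u], and
   [N = t (x - y)(x + y)^*].  Then [N^2 = 0], so [S = 1 + N] has inverse [1 - N],
   and compressing [S^-1 (A (+) B) S] to [x] gives [p - t^2 (p - q)], where
   [p = v^* A v] and [q = u^* B u].  Apply this to [f (W0 (+) W)] with [t = i e],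
   [e] so small that openness of Omega keeps the conjugated point inside: for
   [w] in the ball, [Re <p + e^2 (p - q), w> <= 1].  Hence if [Re <p, w>] is
   close to [1], so is [Re <q, w>], uniformly in [w], [v], [u].  As [f W0] lies
   on the boundary, [Re <p, w>] comes arbitrarily close to [1]; since [q] is in
   the unit ball, this forces [q] to be close to [w].  Thus all the compressions
   [u^* f(W) u], over all [W] and unit [u], coincide, and polarization shows that
   [f] is constant. *)
Require Import Defs.
From mathcomp Require Import all_boot all_order all_algebra.
From mathcomp Require Import all_classical all_reals all_analysis.
From mathcomp Require Import ring.

Set Implicit Arguments.
Unset Strict Implicit.
Unset Printing Implicit Defensive.

Import Order.TTheory GRing.Theory Num.Theory.
Import numFieldNormedType.Exports ArrowAsProduct.

Local Open Scope classical_set_scope.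
Local Open Scope ring_scope.
Local Open Scope sesquilinear_scope.

(** * Neighbourhoods in finite products, with one radius for all coordinates *)

Lemma nbhs_fin_prodP (K : numFieldType) (I : finType) (T : pseudoMetricType K)
    (X : I -> T) (A : set (I -> T)) :
  nbhs X A <-> exists2 r : K, 0 < r &
    forall Y : I -> T, (forall i, ball (X i) r (Y i)) -> A Y.
Proof.
pose p i := @proj _ (fun _ : I => T : topologicalType) i.
split=> [XA|[r r0 rA]].
  pose F := filter_from [set r : K | 0 < r]
    (fun r => [set Y : I -> T | forall i, ball (X i) r (Y i)]).
  have FF : Filter F.
    apply: filter_from_filter; first by exists 1 => /=; exact: ltr01.
    move=> r s /= r0 s0.
    (* The order of [K] is partial; positive radii are real, hence comparable, so their minimum
       serves both boxes. *)
    have rs : (r >=< s)%O by apply: real_comparable; exact: gtr0_real.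
    exists (Order.min r s) => [|Y /= XY]; first by rewrite minEle; case: ifP.
    split=> i; apply: le_ball (XY i).
      by rewrite comparable_ge_min // lexx.
    by rewrite comparable_ge_min // lexx orbT.
  (* The product topology is the supremum of the topologies induced by the coordinates, so
     convergence of the filter of boxes can be checked one coordinate at a time. *)
  suff : F --> X by move=> /(_ _ XA).
  apply/cvg_sup => i.
  have si : p i @` setT = setT.
    by rewrite eqEsubset; split => // y _; exists (fun=> y).
  apply/cvg_image => // Q /nbhs_ballP [e e0 eQ].
  exists (p i @^-1` Q); last by rewrite image_preimage.
  by exists e => // Y XY /=; apply: eQ; exact: XY.
have near_coord i : nbhs X [set Y : I -> T | ball (X i) r (Y i)].
  by apply: (@proj_continuous _ (fun _ : I => T : topologicalType) i X);
     exact: nbhsx_ballx.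
(* Finiteness of [I] makes the intersection of the coordinate neighbourhoods a neighbourhood. *)
by apply: filterS (filter_forall _ near_coord) => Y XY; apply: rA.
Qed.

Lemma nbhs_mxtupleP (R : realType) (k n : nat) (X : mxtuple R k n)
    (A : set (mxtuple R k n)) :
  nbhs X A <-> exists2 r : CC R, 0 < r &
    forall Y : mxtuple R k n,
      (forall j a b, `|X j a b - Y j a b| < r) -> A Y.
Proof.
apply: (iff_trans (@nbhs_fin_prodP (CC R) 'I_k 'M[CC R]_n X A)).
split=> -[r r0 rA]; exists r => // Y XY; apply: rA.
  by move=> j; split=> // a b; exact: XY.
by move=> j a b; have [_] := XY j; apply.
Qed.

(** * Quadratic forms of matrices, polarization and conjugation by shears *)

Section QuadraticForm.
Variable C : numClosedFieldType.
Implicit Types (n : nat) (t : C).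

Definition qform n (A : 'M[C]_n) (v : 'cV[C]_n) : C := (v^t* *m A *m v) 0 0.

(** The inner product of C^d, conjugate linear in [w]; its real part on a tuple of compressions is
    what the inequalities of [maxball] bound. *)
Definition pairing d (z w : 'I_d -> C) : C := \sum_(j < d) (w j)^* * z j.

Lemma adjmx0 m n : (0 : 'M[C]_(m, n))^t* = 0.
Proof. by rewrite trmx0 map_mx0. Qed.

Lemma adjmxM m n p (A : 'M[C]_(m, n)) (B : 'M[C]_(n, p)) :
  (A *m B)^t* = B^t* *m A^t*.
Proof. by rewrite trmx_mul map_mxM. Qed.

Lemma adjmxZ m n t (A : 'M[C]_(m, n)) : (t *: A)^t* = t^* *: A^t*.
Proof. by apply/matrixP => i j; rewrite !mxE rmorphM. Qed.

Lemma adjmxD m n (A B : 'M[C]_(m, n)) : (A + B)^t* = A^t* + B^t*.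
Proof. by apply/matrixP => i j; rewrite !mxE rmorphD. Qed.

Lemma qformD n (A B : 'M[C]_n) v : qform (A + B) v = qform A v + qform B v.
Proof. by rewrite /qform mulmxDr mulmxDl mxE. Qed.

Lemma qformZ n t (A : 'M[C]_n) v : qform (t *: A) v = t * qform A v.
Proof. by rewrite /qform -scalemxAr -scalemxAl mxE. Qed.

Lemma qformB n (A B : 'M[C]_n) v : qform (A - B) v = qform A v - qform B v.
Proof. by rewrite qformD -scaleN1r qformZ mulN1r. Qed.

Lemma qform_sum n d (A : 'I_d -> 'M[C]_n) (c : 'I_d -> C) v :
  qform (\sum_j c j *: A j) v = \sum_j c j * qform (A j) v.
Proof.
rewrite /qform mulmx_sumr mulmx_suml summxE; apply: eq_bigr => j _.
exact: qformZ.
Qed.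

Lemma qform_adj n (A : 'M[C]_n) v : qform (A^t*) v = (qform A v)^*.
Proof.
by rewrite /qform -[in LHS](trmxCK v) -2!adjmxM trmxCK mulmxA !mxE.
Qed.

Lemma qform1 n (v : 'cV[C]_n) : qform 1%:M v = \sum_i `|v i 0| ^+ 2.
Proof.
rewrite /qform mulmx1 mxE; apply: eq_bigr => i _.
by rewrite !mxE mulrC normCK.
Qed.

Lemma qform_scale n (A : 'M[C]_n) t v :
  qform A (t *: v) = `|t| ^+ 2 * qform A v.
Proof.
rewrite /qform adjmxZ -!(scalemxAl, scalemxAr) !mxE.
by rewrite normCK; ring.
Qed.

Lemma qform_block0r m n (A : 'M[C]_m) (B : 'M[C]_n) v :
  qform (block_mx A 0 0 B) (col_mx v 0) = qform A v.
Proof.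
rewrite /qform tr_col_mx map_row_mx adjmx0 mul_row_block mul_row_col.
by rewrite !(mulmx0, mul0mx, addr0).
Qed.

Lemma qform_block0l m n (A : 'M[C]_m) (B : 'M[C]_n) v :
  qform (block_mx A 0 0 B) (col_mx 0 v) = qform B v.
Proof.
rewrite /qform tr_col_mx map_row_mx adjmx0 mul_row_block mul_row_col.
by rewrite !(mulmx0, mul0mx, add0r).
Qed.

Lemma qform_unitP n (v : 'cV[C]_n) : qform 1%:M v = 1 -> v^t* *m v = 1%:M.
Proof.
by rewrite /qform mulmx1 => v1; apply/matrixP => i j; rewrite !ord1 v1 mxE.
Qed.

Lemma unit_multiple n (v : 'cV[C]_n) :
  v != 0 -> exists2 u, qform 1%:M u = 1 & exists t, v = t *: u.
Proof.
move=> v0; pose s := qform 1%:M v.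
have s_gt0 : 0 < s.
  rewrite lt_def /s qform1; apply/andP; split; last first.
    by apply: sumr_ge0 => i _; rewrite exprn_ge0.
  apply: contra v0; rewrite psumr_eq0; last by move=> i _; rewrite exprn_ge0.
  move=> /allP h; apply/eqP/matrixP => i j; rewrite ord1 mxE.
  by have := h i (mem_index_enum _); rewrite expf_eq0 /= normr_eq0 => /eqP.
have r0 : sqrtC s != 0 by rewrite sqrtC_eq0 gt_eqF.
exists ((sqrtC s)^-1 *: v); last first.
  by exists (sqrtC s); rewrite scalerA divff ?scale1r.
rewrite qform_scale normfV exprVn ger0_norm ?sqrtC_ge0 ?ltW // sqrtCK mulVf //.
by rewrite gt_eqF.
Qed.

Lemma coord_le1 n (v : 'cV[C]_n) i : qform 1%:M v = 1 -> `|v i 0| <= 1.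
Proof.
rewrite qform1 => v1; rewrite -(@expr_le1 _ 2) // -v1 (bigD1 i) //= lerDl.
by apply: sumr_ge0 => j _; rewrite exprn_ge0.
Qed.

Lemma mulmx_bound m n p (A : 'M[C]_(m, n)) (B : 'M[C]_(n, p)) (a b : C) :
  (forall i j, `|A i j| <= a) -> (forall i j, `|B i j| <= b) ->
  forall i j, `|(A *m B) i j| <= n%:R * (a * b).
Proof.
move=> Aa Bb i j; rewrite mxE; apply: le_trans (ler_norm_sum _ _ _) _.
rewrite mulr_natl -[n in _ *+ n]card_ord -sumr_const; apply: ler_sum => l _.
by rewrite normrM ler_pM.
Qed.

(* Polarization at [e_a + t e_b] with [t = 1] and [t = i]. *)
Lemma qform_eq0 n (A : 'M[C]_n) : (forall v, qform A v = 0) -> A = 0.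
Proof.
move=> A0.
have E a b t : A a a + t * A a b + t^* * A b a + `|t| ^+ 2 * A b b = 0.
  rewrite -[RHS](A0 (delta_mx a 0 + t *: delta_mx b 0)) /qform.
  rewrite adjmxD adjmxZ !trmx_delta !map_delta_mx.
  rewrite !(mulmxDl, mulmxDr) -!(scalemxAl, scalemxAr) scalerA -normCKC.
  by rewrite -!(rowE, colE) !mxE; ring.
have D a : A a a = 0.
  by have := E a a 0; rewrite conjC0 normr0 expr0n !mul0r !addr0.
apply/matrixP => a b; rewrite mxE.
have := E a b 1; rewrite conjC1 normr1 !D => h1.
have := E a b 'i; rewrite conjCi normCi !D => hi.
(* Adding ['i] times the identity for [t = 1] to the one for [t = 'i] cancels [A b a]. *)
have : 2 * 'i * A a b = 0.
  transitivity ('i * (0 + 1 * A a b + 1 * A b a + 1 ^+ 2 * 0) +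
                (0 + 'i * A a b + - 'i * A b a + 1 ^+ 2 * 0)); first by ring.
  by rewrite h1 hi mulr0 addr0.
by move/eqP; rewrite !mulf_eq0 pnatr_eq0 (negPf (neq0Ci _)) /= => /eqP.
Qed.

(** The form of [A - l%:M] vanishes on unit vectors, hence on all vectors by homogeneity, and
    polarization applies. *)
Lemma qform_const n (A : 'M[C]_n) l :
  (forall u, qform 1%:M u = 1 -> qform A u = l) -> A = l%:M.
Proof.
move=> Al; apply/eqP; rewrite -subr_eq0; apply/eqP/qform_eq0 => v.
have [->|/unit_multiple[u u1 [t ->]]] := eqVneq v 0.
  by rewrite /qform mulmx0 mxE.
by rewrite qform_scale qformB Al // -scalemx1 qformZ u1 mulr1 subrr mulr0.
Qed.

(** For orthonormal [x] and [y] the vectors [x + y] and [x - y] are orthogonal, so the rank-one [N]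
    kills its own range. *)
Lemma shear_sqr0 n (x y : 'cV[C]_n) (N := (x - y) *m (x + y)^t*) :
  x^t* *m x = 1%:M -> y^t* *m y = 1%:M ->
  x^t* *m y = 0 -> y^t* *m x = 0 -> N *m N = 0.
Proof.
move=> xx yy xy yx; have z : (x + y)^t* *m (x - y) = 0.
  rewrite adjmxD mulmxDl !mulmxBr xx yy xy yx.
  by rewrite subr0 sub0r subrr.
by rewrite /N mulmxA -(mulmxA (x - y)) z mulmx0 mul0mx.
Qed.

Lemma invmx_shear n (N : 'M[C]_n) : N *m N = 0 ->
  1%:M + N \in unitmx /\ invmx (1%:M + N) = 1%:M - N.
Proof.
move=> N0; have SS : (1%:M + N) *m (1%:M - N) = 1%:M.
  by rewrite mulmxBr mulmx1 mulmxDl mul1mx N0 addr0 addrK.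
have [uS _] := mulmx1_unit SS; split=> //.
by have := mulKmx uS (1%:M - N); rewrite SS mulmx1.
Qed.

(* The terms linear in [t] cancel, so an imaginary [t] pushes [qform A x] away
   from [qform A y]. *)
Lemma qform_shear n (A : 'M[C]_n) (x y : 'cV[C]_n) t
    (N := t *: ((x - y) *m (x + y)^t*)) :
  x^t* *m x = 1%:M -> y^t* *m y = 1%:M ->
  x^t* *m y = 0 -> y^t* *m x = 0 ->
  x^t* *m A *m y = 0 -> y^t* *m A *m x = 0 ->
  qform ((1%:M - N) *m A *m (1%:M + N)) x =
  qform A x - t ^+ 2 * (qform A x - qform A y).
Proof.
move=> xx yy xy yx xAy yAx.
have Sx : (1%:M + N) *m x = x + t *: (x - y).
  have z : (x + y)^t* *m x = 1%:M by rewrite adjmxD mulmxDl xx yx addr0.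
  by rewrite /N mulmxDl mul1mx -scalemxAl -mulmxA z mulmx1.
have xS : x^t* *m (1%:M - N) = x^t* - t *: (x^t* + y^t*).
  rewrite /N mulmxBr mulmx1 -scalemxAr mulmxA mulmxBr.
  by rewrite xx xy subr0 mul1mx adjmxD.
rewrite /qform !mulmxA xS -!mulmxA Sx.
have -> : (x^t* - t *: (x^t* + y^t*)) *m (A *m (x + t *: (x - y))) =
   x^t* *m A *m x - t ^+ 2 *: (x^t* *m A *m x - y^t* *m A *m y).
  rewrite !(mulmxDl, mulmxDr, mulmxN, mulNmx, =^~ scalemxAl, =^~ scalemxAr).
  rewrite !mulmxA xAy yAx.
  move: (x^t* *m A *m x) (y^t* *m A *m y) => a b.
  by apply/matrixP => i j; rewrite !mxE; ring.
rewrite !mulmxA; move: (x^t* *m A *m x) (y^t* *m A *m y) => a b.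
by rewrite !mxE.
Qed.

(** The difference is [N *m X - X *m N + N *m X *m N]; since [e <= 1], its quadratic part is also
    bounded linearly in [e]. *)
Lemma shear_conj_bound n (X N : 'M[C]_n) (M e : C) :
  (forall a b, `|X a b| <= M) -> (forall a b, `|N a b| <= e) -> e <= 1 ->
  forall a b, `|X a b - ((1%:M - N) *m X *m (1%:M + N)) a b| <=
    (n%:R * 2 + n%:R ^+ 2) * M * e.
Proof.
move=> XM Ne e1 a b.
have M0 : 0 <= M by apply: le_trans (XM a b).
have e0 : 0 <= e by apply: le_trans (Ne a b).
have -> : (1%:M - N) *m X *m (1%:M + N) = X - (N *m X - X *m N + N *m X *m N).
  rewrite mulmxBl mul1mx mulmxDr mulmx1 mulmxBl.
  move: (N *m X) (X *m N) (N *m X *m N) => A1 A2 A3.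
  by apply/matrixP => i j; rewrite !mxE; ring.
have h1 := mulmx_bound Ne XM; have h2 := mulmx_bound XM Ne.
have h3 := mulmx_bound h1 Ne a b.
move: (h1 a b) (h2 a b) h3 => {h1 h2}.
move: (N *m X) (X *m N) (N *m X *m N) => A1 A2 A3 h1 h2 h3.
rewrite !mxE subKr; apply: le_trans (ler_normD _ _) _.
apply: le_trans (lerD (ler_normB _ _) (lexx _)) _.
apply: le_trans (lerD (lerD h1 h2) h3) _.
have -> : (n%:R * 2 + n%:R ^+ 2) * M * e =
  n%:R * (e * M) + n%:R * (M * e) + n%:R * (n%:R * (e * M) * 1) by ring.
by rewrite lerD2l !ler_wpM2l // ?mulr_ge0.
Qed.

End QuadraticForm.

(** * Rotundity of the Euclidean ball *)

Section Pairing.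
Variable C : numClosedFieldType.
Implicit Types (d : nat) (t : C).

Lemma pairingD d (z z' w : 'I_d -> C) :
  pairing (fun j => z j + z' j) w = pairing z w + pairing z' w.
Proof. by rewrite -big_split; apply: eq_bigr => j _; rewrite mulrDr. Qed.

Lemma pairingZ d t (z w : 'I_d -> C) :
  pairing (fun j => t * z j) w = t * pairing z w.
Proof. by rewrite mulr_sumr; apply: eq_bigr => j _; rewrite mulrCA. Qed.

Lemma normsqrB (a b : C) :
  `|a - b| ^+ 2 = `|a| ^+ 2 + `|b| ^+ 2 - 2 * 'Re (b^* * a).
Proof.
rewrite ReE !normCK rmorphB rmorphM /= conjCK.
have n2 : (2 : C) != 0 by rewrite pnatr_eq0.
by field.
Qed.

(** The parallelogram law, with the square of the sum dropped. *)
Lemma normsqrB_le (a b : C) : `|a - b| ^+ 2 <= 2 * (`|a| ^+ 2 + `|b| ^+ 2).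
Proof.
have -> : 2 * (`|a| ^+ 2 + `|b| ^+ 2) = `|a - b| ^+ 2 + `|a + b| ^+ 2.
  by rewrite !normCK rmorphB rmorphD /=; ring.
by rewrite lerDl exprn_ge0.
Qed.

Lemma ler_term_sum d (g : 'I_d -> C) j :
  (forall i, 0 <= g i) -> g j <= \sum_i g i.
Proof.
by move=> g0; rewrite (bigD1 j) //= lerDl sumr_ge0.
Qed.

(** Expand [|z - w|^2 = |z|^2 + |w|^2 - 2 Re <z, w>] and bound both squared norms by 1: a nearly
    maximal pairing forces the vectors together. *)
Lemma pairing_near d (z w : 'I_d -> C) e j :
  \sum_i `|z i| ^+ 2 <= 1 -> \sum_i `|w i| ^+ 2 <= 1 ->
  1 - 'Re (pairing z w) <= e -> `|z j - w j| ^+ 2 <= 2 * e.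
Proof.
move=> z1 w1 zw.
apply: le_trans (ler_term_sum (g := fun j => `|z j - w j| ^+ 2) j _) _.
  by move=> i; rewrite exprn_ge0.
have -> : \sum_i `|z i - w i| ^+ 2 = \sum_i `|z i| ^+ 2 + \sum_i `|w i| ^+ 2 -
    2 * 'Re (pairing z w).
  rewrite /pairing raddf_sum mulr_sumr -sumrN -!big_split /=.
  by apply: eq_bigr => i _; rewrite normsqrB.
apply: le_trans (lerD (lerD z1 w1) (lexx _)) _.
have -> : 1 + 1 - 2 * 'Re (pairing z w) = 2 * (1 - 'Re (pairing z w)) by ring.
by rewrite ler_wpM2l.
Qed.

Lemma eq_of_pairing_near d (z z' : 'I_d -> C) :
  \sum_i `|z i| ^+ 2 <= 1 -> \sum_i `|z' i| ^+ 2 <= 1 ->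
  (forall e : C, 0 < e -> exists w : 'I_d -> C,
    [/\ \sum_i `|w i| ^+ 2 <= 1, 1 - 'Re (pairing z w) <= e &
        1 - 'Re (pairing z' w) <= e]) ->
  z =1 z'.
Proof.
move=> z1 z1' near j; apply/eqP; rewrite -subr_eq0 -normr_eq0 -sqrf_eq0.
set s := _ ^+ 2; have : 0 <= s by rewrite exprn_ge0.
rewrite le_eqVlt eq_sym => /predU1P[/eqP //|s_gt0].
(* For [e = s / 16] both coordinates are within squared distance [s / 8] of [w j], so
   [s <= 2 * (s / 8 + s / 8) = s / 2], which is absurd for positive [s]. *)
have s16 : 0 < s / 16 by rewrite divr_gt0 // ltr0n.
have [w [w1 zw zw']] := near _ s16.
have h := pairing_near j z1 w1 zw; have h' := pairing_near j z1' w1 zw'.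
have : s <= s / 2.
  have -> : s / 2 = 2 * (2 * (s / 16) + 2 * (s / 16)).
    by field.
  apply: le_trans (ler_wpM2l _ (lerD h h')); last by rewrite ler0n.
  rewrite /s; have -> : z j - z' j = (z j - w j) - (z' j - w j) by ring.
  exact: normsqrB_le.
have n2 : (2 : C) != 0 by rewrite pnatr_eq0.
rewrite -subr_ge0; have -> : s / 2 - s = - (s / 2) by field.
rewrite oppr_ge0 => /(lt_le_trans (divr_gt0 s_gt0 (ltr0Sn _ 1))).
by rewrite ltxx.
Qed.

End Pairing.

(** * The max ball in terms of compressions to vectors *)

Section MaxBall.
Variable R : realType.
Local Notation C := (CC R).

Lemma enorm_le1 d (w : 'I_d -> C) :
  (enorm w <= 1) = (\sum_i `|w i| ^+ 2 <= 1).
Proof.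
by rewrite /enorm -[X in _ <= X]sqrtC1 ler_sqrtC // qualifE /= ?ler01 //
  sumr_ge0 // => i _; rewrite exprn_ge0.
Qed.

(** Compressing [Remx] of a matrix to [v] gives the real part of its compression, so the matrix
    inequality splits into scalar ones. *)
Lemma maxballP d n (Z : mxtuple R d n) :
  maxball R d n Z <->
  forall (w : 'I_d -> C) (v : 'cV[C]_n), \sum_i `|w i| ^+ 2 <= 1 ->
    'Re (pairing (fun j => qform (Z j) v) w) <= qform 1%:M v.
Proof.
have E (w : 'I_d -> C) (v : 'cV[C]_n) :
    (0 <= (v^t* *m (1%:M - Remx (\sum_j (w j)^* *: Z j)) *m v) 0 0) =
    ('Re (pairing (fun j => qform (Z j) v) w) <= qform 1%:M v).
  rewrite -/(qform _ v) qformB subr_ge0 /Remx qformZ qformD qform_adj qform_sum.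
  by rewrite ReE mulrC.
split=> [ZM w v w1|ZM w w1 v].
  by rewrite -E; apply: ZM; rewrite enorm_le1.
by rewrite E; apply: ZM; rewrite -enorm_le1.
Qed.

(** Test against the normalized vector of compressions: its pairing with the original one is the
    Euclidean norm [sqrtC s]. *)
Lemma maxball_compression d n (Z : mxtuple R d n) (u : 'cV[C]_n) :
  maxball R d n Z -> qform 1%:M u = 1 -> \sum_j `|qform (Z j) u| ^+ 2 <= 1.
Proof.
move=> /maxballP ZM u1; set s := \sum_j _.
have : 0 <= s by apply: sumr_ge0 => i _; rewrite exprn_ge0.
rewrite le_eqVlt => /predU1P[<-|s_gt0]; first exact: ler01.
have r_gt0 : 0 < sqrtC s by rewrite sqrtC_gt0.
have := ZM (fun j => (sqrtC s)^-1 * qform (Z j) u) u.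
have -> : \sum_i `|(sqrtC s)^-1 * qform (Z i) u| ^+ 2 = 1.
  under eq_bigr do rewrite normrM exprMn.
  rewrite -mulr_sumr -/s normfV exprVn gtr0_norm // sqrtCK mulVf //.
  by rewrite gt_eqF.
move=> /(_ (lexx _)); rewrite u1.
have -> : pairing (fun j => qform (Z j) u)
    (fun j => (sqrtC s)^-1 * qform (Z j) u) = sqrtC s.
  rewrite /pairing; under eq_bigr do rewrite rmorphM -mulrA -normCKC /=.
  rewrite -mulr_sumr -/s conj_Creal ?rpredV ?gtr0_real //.
  by rewrite -{2}(sqrtCK s) expr2 mulKf // gt_eqF.
rewrite (Creal_ReP _ (gtr0_real r_gt0)) => r1.
by rewrite -(sqrtCK s) expr_le1 // ltW.
Qed.

End MaxBall.

(** * Near-extremal functionals at boundary points *)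

Section NC.
Variable R : realType.
Local Notation C := (CC R).

Lemma ler_Re_norm (z : C) : 'Re z <= `|z|.
Proof.
exact: le_trans (real_ler_norm (Creal_Re z)) (leif_normC_Re_Creal z).1.
Qed.

Lemma qform_bound n (A : 'M[C]_n) (u : 'cV[C]_n) e :
  (forall a b, `|A a b| <= e) -> qform 1%:M u = 1 ->
  `|qform A u| <= n%:R ^+ 2 * e.
Proof.
move=> Ae u1.
have ua a (b : 'I_1) : `|u a b| <= 1 by rewrite ord1 coord_le1.
have ub (a : 'I_1) b : `|u^t* a b| <= 1 by rewrite !mxE norm_conjC ua.
apply: le_trans (mulmx_bound (mulmx_bound ub Ae) ua 0 0) _.
by rewrite mul1r mulr1 mulrA expr2.
Qed.

(** Otherwise all these pairings stay below 1 by the margin [e]; a small perturbation of [Z] uses up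
    at most this margin, so [Z] would be interior. *)
Lemma boundary_maxball d n (Z : mxtuple R d n) (e : C) :
  boundary (maxball R d n) Z -> 0 < e ->
  exists (w : 'I_d -> C) (u : 'cV[C]_n),
    [/\ \sum_i `|w i| ^+ 2 <= 1, qform 1%:M u = 1 &
        1 - 'Re (pairing (fun j => qform (Z j) u) w) < e].
Proof.
move=> [_ Zint] e0; apply: contrapT => far; apply: Zint.
have {}far (w : 'I_d -> C) (u : 'cV[C]_n) :
    \sum_i `|w i| ^+ 2 <= 1 -> qform 1%:M u = 1 ->
    'Re (pairing (fun j => qform (Z j) u) w) <= 1 - e.
  move=> w1 u1; set P := 'Re _.
  (* [C] is only partially ordered: negating a strict inequality requires real sides. *)
  have P1 : 1 - P \is Num.real by rewrite rpredB ?rpred1 ?Creal_Re.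
  have -> : (P <= 1 - e) = (e <= 1 - P) by rewrite !lerBrDr addrC.
  rewrite (real_leNgt (gtr0_real e0) P1).
  by apply/negP => lte; apply: far; exists w, u.
(* Each of the [d] coordinates contributes at most [n ^ 2] times the entrywise error; the added 1
   keeps [D] positive even if [d] or [n] is 0. *)
pose D : C := d%:R * n%:R ^+ 2 + 1.
have D0 : 0 < D by rewrite ltr_wpDl // mulr_ge0 ?exprn_ge0 ?ler0n.

apply/nbhs_mxtupleP; exists (e / D); first by rewrite divr_gt0.
move=> Y ZY; apply/maxballP => w v w1.
have [->|/unit_multiple[u u1 [t ->]]] := eqVneq v 0.
  rewrite -(scale0r 0) qform_scale normr0 expr0n mul0r.
  under [pairing _ _]eq_bigr do rewrite qform_scale normr0 expr0n mul0r mulr0.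
  by rewrite big1 // raddf0.
rewrite qform_scale u1 mulr1.
have -> : pairing (fun j => qform (Y j) (t *: u)) w =
    `|t| ^+ 2 * pairing (fun j => qform (Y j) u) w.
  by rewrite -pairingZ; apply: eq_bigr => j _; rewrite qform_scale.
rewrite ReMl ?rpredX ?normr_real // -[leRHS]mulr1 ler_wpM2l ?exprn_ge0 //.
have -> : pairing (fun j => qform (Y j) u) w =
    pairing (fun j => qform (Z j) u) w +
    pairing (fun j => qform (Y j - Z j) u) w.
  by rewrite -pairingD; apply: eq_bigr => j _; rewrite qformB subrKC.
rewrite raddfD /= -[leRHS](subrK e) lerD ?far //.
apply: le_trans (ler_Re_norm _) _; apply: le_trans (ler_norm_sum _ _ _) _.
have wj j : `|w j| <= 1.
  rewrite -(@expr_le1 _ 2) //; apply: le_trans w1.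
  by apply: (ler_term_sum (g := fun j => `|w j| ^+ 2)) => i; rewrite exprn_ge0.
apply: (@le_trans _ _ (\sum_(j < d) n%:R ^+ 2 * (e / D))).
  apply: ler_sum => j _; rewrite normrM norm_conjC -[leRHS]mul1r.
  rewrite ler_pM ?wj // qform_bound // => a b.
  by rewrite !mxE distrC ltW.
rewrite sumr_const card_ord -[_ *+ d]mulr_natl mulrA mulrCA -[leRHS]mulr1.
by rewrite ler_wpM2l ?(ltW e0) // ler_pdivrMr // mul1r lerDl ler01.
Qed.

(** * Nc functions with values in the max ball *)

Section NCMap.
Variables (k d : nat) (Omega : ncsubset R k) (f : ncmap R k d).
Hypotheses (ncO : is_nc_set Omega) (openO : nc_open Omega).
Hypotheses (ncf : nc_function Omega f)
  (fM : forall n (W : mxtuple R k n), Omega n W -> maxball R d n (f W)).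

(** The radius is uniform over [N], so it can be fixed before the vectors from which the shear is
    built. *)
Lemma nc_shear_near n (X : mxtuple R k n) : Omega n X ->
  exists2 e : C, 0 < e & forall N : 'M[C]_n, (forall a b, `|N a b| <= e) ->
    Omega n (fun j => (1%:M - N) *m X j *m (1%:M + N)).
Proof.
move=> OX; have /nbhs_mxtupleP[r r0 rO] := open_nbhs_nbhs (conj (openO n) OX).
pose M : C := \sum_j \sum_a \sum_b `|X j a b|.
have XM j a b : `|X j a b| <= M.
  apply: le_trans (ler_term_sum j _).
    apply: le_trans (ler_term_sum a _).
      by apply: (ler_term_sum (g := fun b => `|X j a b|)).
    by move=> i; rewrite sumr_ge0.
  by move=> i; rewrite sumr_ge0 // => i' _; rewrite sumr_ge0.
have M0 : 0 <= M by do 3 (apply: sumr_ge0 => ? _).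
pose D := (n%:R * 2 + n%:R ^+ 2) * M.
have D0 : 0 <= D by rewrite mulr_ge0 // addr_ge0 ?mulr_ge0 ?exprn_ge0 ?ler0n.
have Dr : 0 < D + r + 1 by rewrite ltr_wpDr ?ler01 // ltr_wpDl.
(* The summand [r] makes the radius at most 1, and [D < D + r + 1] keeps the displacement below
   [r]. *)
exists (r / (D + r + 1)); first by rewrite divr_gt0.
move=> N Ne; apply: rO => j a b.
apply: le_lt_trans (shear_conj_bound (XM j) Ne _ a b) _.
  by rewrite ler_pdivrMr // mul1r -addrA addrCA lerDl addr_ge0 ?ler01.
rewrite -/D mulrCA gtr_pMr // ltr_pdivrMr // mul1r -addrA ltrDl.
by rewrite addr_gt0 ?ltr01.
Qed.

(** A Harnack-type estimate: [c] depends on the two points but not on [w], [v], [u]. *)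
Lemma nc_gap_compare n m (W0 : mxtuple R k n) (W : mxtuple R k m) :
  Omega n W0 -> Omega m W -> exists2 c : C, 0 <= c &
  forall (w : 'I_d -> C) (v : 'cV[C]_n) (u : 'cV[C]_m),
    \sum_i `|w i| ^+ 2 <= 1 -> qform 1%:M v = 1 -> qform 1%:M u = 1 ->
    1 - 'Re (pairing (fun j => qform (f W j) u) w) <=
    c * (1 - 'Re (pairing (fun j => qform (f W0 j) v) w)).
Proof.
move=> OW0 OW; have OX := ncO OW0 OW.
have [e0 e0_gt0 eO] := nc_shear_near OX.
(* The entries of [x - y] and [x + y] have modulus at most 2, so those of their rank-one product
   have modulus at most 4. *)
pose e := e0 / 4.
have e_gt0 : 0 < e by rewrite divr_gt0 ?ltr0n.
have e2_gt0 : 0 < e ^+ 2 by rewrite exprn_gt0.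
exists (1 + e ^- 2); first by rewrite addr_ge0 ?ler01 ?invr_ge0 ?ltW.
move=> w v u w1 v1 u1.
pose x : 'cV[C]_(n + m) := col_mx v 0; pose y : 'cV[C]_(n + m) := col_mx 0 u.
have x1 : qform 1%:M x = 1 by rewrite scalar_mx_block qform_block0r.
have y1 : qform 1%:M y = 1 by rewrite scalar_mx_block qform_block0l.
have [xx yy] := (qform_unitP x1, qform_unitP y1).
(* General blocks serve twice: identity blocks give orthogonality of [x] and [y], and the values of
   [f] give the vanishing cross terms of [qform_shear]. *)
have xAy (A : 'M[C]_n) (B : 'M[C]_m) : x^t* *m block_mx A 0 0 B *m y = 0.
  rewrite tr_col_mx map_row_mx adjmx0 mul_row_block mul_row_col.
  by rewrite !(mulmx0, mul0mx, addr0).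
have yAx (A : 'M[C]_n) (B : 'M[C]_m) : y^t* *m block_mx A 0 0 B *m x = 0.
  rewrite tr_col_mx map_row_mx adjmx0 mul_row_block mul_row_col.
  by rewrite !(mulmx0, mul0mx, addr0).
have xy : x^t* *m y = 0 by rewrite -[x^t*]mulmx1 scalar_mx_block xAy.
have yx : y^t* *m x = 0 by rewrite -[y^t*]mulmx1 scalar_mx_block yAx.
pose N := ('i * e) *: ((x - y) *m (x + y)^t*).
have N0 : N *m N = 0.
  by rewrite /N -scalemxAl -scalemxAr (shear_sqr0 xx yy xy yx) !scaler0.
have Ne a b : `|N a b| <= e0.
  have xa (s : C) i (j : 'I_1) : `|s| = 1 -> `|(x + s *: y) i j| <= 2.
    move=> s1; rewrite ord1 [(x + _) i 0]mxE [(s *: y) i 0]mxE.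
    apply: le_trans (ler_normD _ _) _.
    by rewrite normrM s1 mul1r -[2]/(1 + 1) lerD ?coord_le1.
  rewrite [N a b]mxE normrM normrM normCi mul1r gtr0_norm //.
  have -> : e0 = e * 4 by rewrite /e divfK // pnatr_eq0.
  rewrite ler_wpM2l ?(ltW e_gt0) //.
  apply: le_trans (mulmx_bound (a := 2) (b := 2) _ _ a b) _.
  - by move=> i j; rewrite -scaleN1r xa // normrN normr1.
  - by move=> i j; rewrite mxE norm_conjC mxE -[y]scale1r xa ?normr1.
  - by rewrite mul1r -natrM.
have [uS iS] := invmx_shear N0.
have simE p (Y : mxtuple R p (n + m)) :
    Defs.similar (1%:M + N) Y = fun j => (1%:M - N) *m Y j *m (1%:M + N).
  by rewrite /Defs.similar iS.
have OY : Omega (n + m)%N (Defs.similar (1%:M + N) (dirsum W0 W)).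
  by rewrite simE; apply: eO.
have /maxballP/(_ w x w1) := fM OY.
rewrite (ncf.2 _ _ _ uS OX OY) (ncf.1 _ _ _ _ OW0 OW) simE x1.
set p := pairing (fun j => qform (f W0 j) v) w.
set q := pairing (fun j => qform (f W j) u) w.
set s := pairing _ w; have -> : s = p + e ^+ 2 * (p - q).
  rewrite -mulN1r /s /p /q -!pairingZ -pairingD -pairingZ -pairingD.
  apply: eq_bigr => j _; congr (_ * _).
  rewrite /dirsum qform_shear // qform_block0r qform_block0l exprMn sqrCi.
  by ring.
rewrite raddfD /= ReMl ?rpredX ?gtr0_real // raddfB /=.
move: ('Re p) ('Re q) => P Q PQ.
(* The excess over [1 - Q] is [e ^- 2] times the slack of the inequality at the sheared point. *)
have -> : (1 + e ^- 2) * (1 - P) =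
    1 - Q + e ^- 2 * (1 - (P + e ^+ 2 * (P - Q))).
  by field; rewrite gt_eqF.
by rewrite lerDl mulr_ge0 ?subr_ge0 // invr_ge0 ltW.
Qed.

Lemma nc_constant_of_boundary n (W0 : mxtuple R k n) :
  Omega n W0 -> boundary (maxball R d n) (f W0) -> nc_constant Omega f.
Proof.
move=> OW0 bW0.
(* Both gaps are compared with the gap at [W0], so a single near-extremal [w] serves [W] and
   [W']. *)
have same m (W : mxtuple R k m) u m' (W' : mxtuple R k m') u' :
    Omega m W -> qform 1%:M u = 1 -> Omega m' W' -> qform 1%:M u' = 1 ->
    (fun j => qform (f W j) u) =1 (fun j => qform (f W' j) u').
  move=> OW u1 OW' u1'.
  apply: eq_of_pairing_near; try by apply: maxball_compression => //; exact: fM.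
  move=> e e0; have [c c0 hc] := nc_gap_compare OW0 OW.
  have [c' c0' hc'] := nc_gap_compare OW0 OW'.
  (* Dividing [e] by this sum brings both gaps under [e]; the 1 covers [c = c' = 0]. *)
  have D0 : 0 < c + c' + 1 by rewrite ltr_wpDl ?addr_ge0 ?ltr01.
  have [w [v [w1 v1 wv]]] := boundary_maxball bW0 (divr_gt0 e0 D0).
  have le_e (b : C) : 0 <= b -> b <= c + c' + 1 -> b * (e / (c + c' + 1)) <= e.
    move=> b0 bD; rewrite mulrCA -[leRHS]mulr1 ler_wpM2l ?(ltW e0) //.
    by rewrite ler_pdivrMr // mul1r.
  exists w; split=> //.
    apply: le_trans (hc _ _ _ w1 v1 u1) _.
    apply: le_trans (ler_wpM2l c0 (ltW wv)) _.
    by rewrite le_e // -addrA lerDl addr_ge0 ?ler01.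
  apply: le_trans (hc' _ _ _ w1 v1 u1') _.
  apply: le_trans (ler_wpM2l c0' (ltW wv)) _.
  by rewrite le_e // addrAC lerDr addr_ge0 ?ler01.
(* Only a unit vector [v] is wanted here; the compression of [f W0] to it supplies the constant. *)
have [w [v [_ v1 _]]] := boundary_maxball bW0 ltr01.
exists (fun j => qform (f W0 j) v) => m W OW; apply/funext => j.
by apply: qform_const => u u1; exact: (same _ W u _ W0 v).
Qed.

End NCMap.
End NC.

Theorem theorem4p7 (R : realType) (k d : nat)
    (Omega : ncsubset R k) (f : ncmap R k d) :
  is_nc_set Omega ->
  nc_open Omega ->
  unitarily_invariant Omega ->
  nc_function Omega f ->
  (forall (n : nat) (W : mxtuple R k n), Omega n W -> maxball R d n (f n W)) ->
  locally_bounded Omega f ->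
  (exists (n : nat) (W0 : mxtuple R k n),
     Omega n W0 /\ boundary (maxball R d n) (f n W0)) ->
  nc_constant Omega f.
Proof.
move=> ncO openO _ ncf fM _ [n [W0 [OW0 bW0]]].
exact: nc_constant_of_boundary OW0 bW0.
Qed.
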